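(* Let $n\ge 1$ and let $a(s)=s^n+a_1s^{n-1}+\cdots+a_n$ and $b(s)=s^n+b_1s^{n-1}+\cdots+b_n$ be real polynomials of degree $n$ that are both Hurwitz stable. Then there exists a real polynomial $c(s)$ such that $c(s)/a(s)$ and $c(s)/b(s)$ are both strictly positive real if and only if $\lambda b(s)+(1-\lambda)a(s)$ is Hurwitz stable (of degree $n$) for every $\lambda\in[0,1]$.
   Context: A real polynomial is Hurwitz stable if all its roots lie in the open left half-plane $\mathrm{Re}[s]<0$. A rational function $f(s)=p(s)/q(s)$ with $p,q$ real polynomials is called strictly positive real (SPR) if (i) $\deg p=\deg q$; (ii) $q$ is Hurwitz stable (so $f$ is analytic in $\mathrm{Re}[s]\ge 0$); (iii) $\mathrm{Re}[f(j\omega)]>0$ for all $\omega\in\mathbb{R}$, where $j=\sqrt{-1}$. *)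

(* Defs.v *)
From mathcomp Require Import all_boot all_order all_algebra.
From mathcomp Require Import reals.
From mathcomp.real_closed Require Import complex.
Set Implicit Arguments. Unset Strict Implicit. Unset Printing Implicit Defensive.
Import Order.TTheory GRing.Theory Num.Theory.
Local Open Scope ring_scope.

Definition cpoly (R : realType) (p : {poly R}) : {poly R[i]} :=
  map_poly (fun x : R => (x%:C)%C) p.

(* p is Hurwitz stable: every complex root lies in Re s < 0
   (the zero polynomial, which has every point as a root, is not stable). *)
Definition hurwitz (R : realType) (p : {poly R}) : Prop :=
  forall z : R[i], root (cpoly p) z -> complex.Re z < 0.

Definition SPR (R : realType) (p q : {poly R}) : Prop :=
  [/\ (size p = size q)%N,
      hurwitz q &
      forall w : R,
        0 < complex.Re ((cpoly p).[Complex 0 w] / (cpoly q).[Complex 0 w])].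

(* Main.v *)
(* Necessity: if [c/a] and [c/b] are SPR then [Re (c conj p) > 0] on the imaginary
   axis for every [p] in the segment, so no root crosses the axis when [a] is
   deformed into [p].

   Sufficiency: let [p_l = a + l (b - a)].  The set of [l] such that a common [c]
   exists for [a] and [p_l] contains [0] and is open; it suffices to show that
   it is closed.  By compactness a limit of common solutions gives [c <> 0] of
   degree at most [n] with [Re (c conj a) >= 0] and [Re (c conj p_l) >= 0] on the
   axis, and we perturb it to [c + e d] with strict inequalities.  Write
   [c = g e] with [g = gcd (c(s), c(-s))]: the roots of [g] are simple and purely
   imaginary, because [Re (h conj a) >= 0] with [deg h <= n - 2] forces [h = 0],
   and [e(s)], [e(-s)] are coprime.  At a root of [g] the value of [d] must be
   prescribed; at another zero of [Re (c conj a)] or [Re (c conj p_l)] only the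
   value of [Im (d conj c)] matters.  All these zeros are double since they are
   minima, so there are at most [2 deg e] of the second kind, which is what
   Bezout's identity between [e(s)] and [e(-s)] can interpolate.  As target values
   we take those of the bisector of [a] and [p_l], which exists as they are nowhere
   antiparallel on the axis. *)
Require Import Defs.
From mathcomp Require Import all_boot all_order all_algebra.
From mathcomp Require Import reals.
From mathcomp.real_closed Require Import complex polyrcf.
From mathcomp Require Import boolp classical_sets topology normedtype derive.
From mathcomp Require Import ring lra zify.
Set Implicit Arguments. Unset Strict Implicit. Unset Printing Implicit Defensive.
Import Order.TTheory GRing.Theory Num.Theory.
Import numFieldNormedType.Exports.
Local Open Scope ring_scope.

Local Notation normc := (@Normc.normc _).

(** Connectedness of the interval. At the supremum of the [l] such that [S] holds on all of
    [[0, l]], closedness gives [S], and openness would push further if that supremum were below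
    1. *)
Lemma unit_interval_ind (R : realType) (S : R -> Prop) : S 0 ->
  (forall l, 0 <= l <= 1 -> S l -> exists2 e, 0 < e &
     forall m, 0 <= m <= 1 -> `|m - l| < e -> S m) ->
  (forall l, 0 <= l <= 1 ->
     (forall e, 0 < e -> exists m, [/\ 0 <= m <= 1, `|m - l| < e & S m]) -> S l) ->
  forall l, 0 <= l <= 1 -> S l.
Proof.
move=> S0 Sopen Sclosed.
pose E := [set l | 0 <= l <= 1 /\ forall m, 0 <= m <= l -> S m]%classic.
have E0 : E 0.
  by split=> [|m /andP[m0 m0']]; [lra|rewrite (_ : m = 0) //; lra].
have supE : has_sup E by split; [exists 0|exists 1 => x [/andP[]]].
have s01 : 0 <= sup E <= 1.
  by rewrite (sup_upper_bound supE) // ge_sup; [|exists 0|move=> x [/andP[]]].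
have below m : 0 <= m < sup E -> S m.
  move=> /andP[m0 ms]; have d0 : 0 < sup E - m by lra.
  by have [x [x01 xS] mx] := sup_adherent d0 supE; apply: xS; lra.
have Ssup : S (sup E).
  have [s0|s0] := leP (sup E) 0; first by rewrite (_ : sup E = 0) //; lra.
  apply: Sclosed => // e e0; have [es|es] := leP e (sup E).
    exists (sup E - e / 2); split; first lra.
      by rewrite (_ : _ - _ = - (e / 2)) ?normrN ?gtr0_norm; lra.
    by apply: below; lra.
  exists 0; split; [lra| |by []].
  by rewrite sub0r normrN gtr0_norm.
have [e e0 Se] := Sopen _ s01 Ssup.
suff s1 : sup E = 1.
  move=> l /andP[l0]; rewrite le_eqVlt => /orP[/eqP->|l1]; first by rewrite -s1.
  by apply: below; lra.
apply/eqP/negPn/negP => s1.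
have {}s1 : sup E < 1 by rewrite lt_neqAle s1; case/andP: s01.
pose x := Num.min 1 (sup E + e / 2).
have xs : sup E < x by rewrite /x lt_min; apply/andP; split; lra.
suff /(sup_upper_bound supE) : E x by lra.
have [x1 xe] : x <= 1 /\ x <= sup E + e / 2.
  by split; rewrite /x ge_min lexx ?orbT.
split; [lra|move=> m /andP[m0 mx]].
have [ms|ms] := ltP m (sup E); first by apply: below; lra.
by apply: Se; [|rewrite ger0_norm]; lra.
Qed.

(** * Stability under homotopy *)

Section Homotopy.
Variable R : realType.
Local Notation C := R[i].
Implicit Types (p d : {poly C}) (z : C).

Definition stable p := forall z, root p z -> complex.Re z < 0.

Lemma ler_Re_normc z : `|complex.Re z| <= normc z.
Proof. by have := normc_ge_Re z; rewrite lecR. Qed.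

Lemma normc_ge0 z : 0 <= normc z.
Proof. exact: le_trans (ler_Re_normc z). Qed.

Lemma normc_prod (I : Type) (s : seq I) (F : I -> C) :
  normc (\prod_(i <- s) F i) = \prod_(i <- s) normc (F i).
Proof. exact: (big_morph _ (@Normc.normcM R) (@Normc.normc1 R)). Qed.

Lemma normcX z k : normc (z ^+ k) = normc z ^+ k.
Proof.
by elim: k => [|k IH]; rewrite ?Normc.normc1 // !exprS Normc.normcM IH.
Qed.

Lemma monic_factor p : p \is monic -> exists rs : seq C,
  p = \prod_(r <- rs) ('X - r%:P).
Proof.
move=> /monicP p1; have [rs prs] := closed_field_poly_normal p.
by exists rs; rewrite prs p1 scale1r.
Qed.

Lemma stable_factor p : p \is monic -> stable p ->
  exists2 rs : seq C, p = \prod_(r <- rs) ('X - r%:P) &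
    forall r, r \in rs -> complex.Re r < 0.
Proof.
move=> /monic_factor[rs ->] st; exists rs => // r rin.
by apply: st; rewrite root_prod_XsubC.
Qed.

Lemma horner_prodXsubC (rs : seq C) z :
  (\prod_(r <- rs) ('X - r%:P)).[z] = \prod_(r <- rs) (z - r).
Proof.
elim: rs => [|r rs IH]; first by rewrite !big_nil hornerC.
by rewrite !big_cons hornerM hornerXsubC IH.
Qed.

(** Each factor [z - r] has real part at least [Re z]. The bound depends on [p] only through its
    degree, so it survives a limit of stable polynomials. *)
Lemma stable_lower_bound p z : p \is monic -> stable p -> 0 <= complex.Re z ->
  complex.Re z ^+ (size p).-1 <= normc p.[z].
Proof.
move=> p1 st z0; have [rs -> rs0] := stable_factor p1 st.
rewrite horner_prodXsubC normc_prod size_prod_XsubC /=.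
elim: rs rs0 => [|r rs IH] rs0; first by rewrite big_nil expr0.
rewrite big_cons exprS ler_pM ?exprn_ge0 //; last first.
  by apply: IH => s sin; apply: rs0; rewrite inE sin orbT.
apply: le_trans (ler_Re_normc _); apply: le_trans (ler_norm _).
by have := rs0 r (mem_head _ _); rewrite raddfB /= => /ltW; lra.
Qed.

Lemma normc_horner_le d z :
  normc d.[z] <= (\sum_(i < size d) normc d`_i) * (1 + normc z) ^+ (size d).-1.
Proof.
rewrite horner_coef mulr_suml.
have: forall (I : Type) (s : seq I) (F : I -> C),
    normc (\sum_(i <- s) F i) <= \sum_(i <- s) normc (F i).
  move=> I s F; elim: s => [|i s IH]; first by rewrite !big_nil Normc.normc0.
  by rewrite !big_cons (le_trans (le_normcD _ _)) // lerD2l.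
move=> /(_ _ _ _) /le_trans; apply; apply: ler_sum => i _.
rewrite Normc.normcM ler_wpM2l ?normc_ge0 // normcX.
have z0 := normc_ge0 z.
apply: (@le_trans _ _ ((1 + normc z) ^+ i)); first by rewrite lerXn2r ?nnegrE; lra.
by rewrite ler_weXn2l; [|lra|rewrite -ltnS prednK //; case: (size d) i => // -[]].
Qed.

(** Since the half-plane is unbounded, compactness is replaced by a bound [1 + |z| <= L |z - r|] for
    each root [r], multiplied over the roots. *)
Lemma stable_dominates p d : p \is monic -> stable p -> (size d <= size p)%N ->
  exists2 K : R, 0 <= K &
    forall z, 0 <= complex.Re z -> normc d.[z] <= K * normc p.[z].
Proof.
move=> p1 st sd; have [rs prs rs0] := stable_factor p1 st.
suff [K K0 HK] : exists2 K : R, 0 <= K &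
    forall z, 0 <= complex.Re z -> (1 + normc z) ^+ (size rs) <= K * normc p.[z].
  have s0 : 0 <= \sum_(i < size d) normc d`_i by apply: sumr_ge0 => i _; apply: normc_ge0.
  exists ((\sum_(i < size d) normc d`_i) * K); first by rewrite mulr_ge0.
  move=> z z0; apply: le_trans (normc_horner_le d z) _.
  rewrite -mulrA ler_wpM2l //; apply: le_trans (HK z z0).
  rewrite ler_weXn2l //; first by have := normc_ge0 z; lra.
  by rewrite prs size_prod_XsubC in sd; case: (size d) sd.
rewrite {}prs {p1 st sd}; elim: rs rs0 => [|r rs IH] rs0.
  by exists 1 => // z _; rewrite big_nil hornerC Normc.normc1 mulr1.
have [|K K0 HK] := IH; first by move=> s sin; apply: rs0; rewrite inE sin orbT.
have r0 := rs0 r (mem_head _ _).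
(* [1 + |z| <= |z - r| + (1 + |r|)], and the constant is absorbed because
   [|z - r| >= - Re r > 0]. *)
pose L := 1 + (1 + normc r) / (- complex.Re r).
have L0 : 0 <= L.
  by rewrite addr_ge0 // divr_ge0 //; [have := normc_ge0 r; lra|lra].
exists (L * K) => [|z z0]; first by rewrite mulr_ge0.
rewrite big_cons hornerM hornerXsubC Normc.normcM exprS mulrACA.
rewrite ler_pM ?HK ?exprn_ge0 //; try by (have := normc_ge0 z; lra).
have h1 : normc z <= normc (z - r) + normc r.
  by rewrite -{1}(subrK r z) le_normcD.
have h2 : - complex.Re r <= normc (z - r).
  apply: le_trans (ler_Re_normc _); apply: le_trans (ler_norm _).
  by rewrite raddfB /=; lra.
have h3 : 1 + normc r <= (1 + normc r) / (- complex.Re r) * normc (z - r).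
  rewrite mulrAC ler_pdivlMr ?oppr_gt0 // ler_wpM2l //.
  by have := normc_ge0 r; lra.
by rewrite /L mulrDl mul1r; lra.
Qed.

Lemma normcR (x : R) : normc x%:C%C = `|x|.
Proof. by rewrite /= expr0n addr0 sqrtr_sqr. Qed.

Lemma monic_addl p d : p \is monic -> (size d < size p)%N -> p + d \is monic.
Proof. by move=> p1 sd; rewrite monicE lead_coefDl // -monicE. Qed.

(** The stable parameters form an open set by [stable_dominates], which makes a small change
    relatively small on the whole closed half-plane. They form a closed set because a limit root
    with positive real part contradicts [stable_lower_bound], and one on the axis is excluded by
    hypothesis. *)
Lemma stable_homotopy p d : p \is monic -> (size d < size p)%N -> stable p ->
  (forall l : R, 0 <= l <= 1 -> forall w, (p + l%:C%C *: d).[Complex 0 w] != 0) ->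
  forall l : R, 0 <= l <= 1 -> stable (p + l%:C%C *: d).
Proof.
move=> p1 sd st axis.
have sz (l : R) : (size (l%:C%C *: d) < size p)%N.
  exact: leq_ltn_trans (size_scale_leq _ _) sd.
have mon l := monic_addl p1 (sz l).
have diff (l m : R) z : (p + m%:C%C *: d).[z] =
    (p + l%:C%C *: d).[z] + (m - l)%:C%C * d.[z].
  by rewrite !hornerE raddfB /=; ring.
apply: unit_interval_ind.
- by rewrite scale0r addr0.
- move=> l l01 stl; have [|K K0 HK] := stable_dominates (d := d) (mon l) stl.
    by rewrite size_polyDl // ltnW.
  exists (K + 1)^-1; first by rewrite invr_gt0; lra.
  move=> m m01 ml z /rootP zm; rewrite ltNge; apply/negP => z0.
  have := HK z z0; have pz0 : 0 < normc (p + l%:C%C *: d).[z].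
    rewrite lt_neqAle normc_ge0 andbT eq_sym; apply/eqP => /Normc.eq0_normc /eqP.
    by move=> /stl; rewrite ltNge z0.
  move: zm; rewrite (diff l) => /eqP; rewrite addr_eq0 => /eqP e.
  rewrite e normcN Normc.normcM normcR in pz0 *.
  have d0 : 0 < normc d.[z].
    rewrite lt_neqAle normc_ge0 andbT; apply/eqP => d0.
    by rewrite -d0 mulr0 ltxx in pz0.
  rewrite -{1}[normc d.[z]]mul1r mulrA ler_pM2r //.
  rewrite -[(K + 1)^-1]mul1r ltr_pdivlMr in ml; [|lra].
  have := normr_ge0 (m - l); nra.
- move=> l l01 near z /rootP zl; rewrite ltNge; apply/negP.
  rewrite le_eqVlt => /orP[/eqP z0|z0].
    have /negP[] := axis l l01 (complex.Im z); apply/eqP; rewrite -[RHS]zl.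
    by case: z z0 {zl} => x y /= ->.
  pose x := complex.Re z ^+ (size p).-1.
  have x0 : 0 < x by rewrite exprn_gt0.
  have dz := normc_ge0 d.[z].
  have [|m [m01 ml stm]] := near (x / (normc d.[z] + 1)).
    by rewrite divr_gt0 //; lra.
  have := @stable_lower_bound _ z (mon m) stm (ltW z0).
  rewrite size_polyDl // (diff l) zl add0r Normc.normcM normcR -/x.
  rewrite ltr_pdivlMr in ml; [|lra].
  have := normr_ge0 (m - l); nra.
Qed.

End Homotopy.

(** * The real part on the imaginary axis *)

Section Parts.
Variable R : realType.
Local Notation C := R[i].

Lemma poly_vanish_nat (F : numDomainType) (p : {poly F}) :
  (forall k : nat, p.[k%:R] = 0) -> p = 0.
Proof.
move=> p0; apply/eqP/negPn/negP => pn0.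
suff: (size [seq (k%:R : F) | k <- iota 0 (size p)] < size p)%N.
  by rewrite size_map size_iota ltnn.
apply: max_poly_roots => //.
  by apply/allP => x /mapP[k _ ->]; apply/rootP.
rewrite map_inj_uniq ?iota_uniq // => j k /eqP.
by rewrite eqr_nat => /eqP.
Qed.

Lemma coef_comp_scaleX (F : comNzRingType) (c : F) (p : {poly F}) k :
  (p \Po (c *: 'X))`_k = p`_k * c ^+ k.
Proof.
rewrite comp_polyE coef_sum; under eq_bigr do rewrite exprZn !coefZ coefXn.
have [kp|kp] := ltnP k (size p).
  rewrite (bigD1 (Ordinal kp)) //= eqxx mulr1 big1 ?addr0 // => j jk.
  rewrite (_ : (k == j)%N = false) ?mulr0 //.
  by apply: contraNF jk => /eqP e; apply/eqP/val_inj; rewrite /= e.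
rewrite nth_default // mul0r big1 // => j _; rewrite gtn_eqF ?mulr0 ?mulr0 //.
exact: leq_trans (ltn_ord j) kp.
Qed.

Lemma coefM_top (F : nzRingType) (p q : {poly F}) m k :
  (size p <= m.+1)%N -> (size q <= k.+1)%N -> (p * q)`_(m + k) = p`_m * q`_k.
Proof.
move=> sp sq; have mk : (m < (m + k).+1)%N by rewrite ltnS leq_addr.
rewrite coefM (bigD1 (Ordinal mk)) //= addKn big1 ?addr0 // => j jm.
have [jlt|jge] := ltnP j m.
  rewrite [q`__]nth_default ?mulr0 //; apply: leq_trans sq _.
  by lia.
rewrite [p`__]nth_default ?mul0r //; apply: leq_trans sp _.
by rewrite ltn_neqAle jge andbT eq_sym; apply: contraNneq jm => e; apply/eqP/val_inj.
Qed.

Lemma horner_map_Re (Q : {poly C}) (w : R) :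
  (map_poly (@complex.Re R) Q).[w] = complex.Re Q.[w%:C%C].
Proof.
rewrite (@horner_coef_wide _ (size Q)) ?size_poly // horner_coef raddf_sum /=.
apply: eq_bigr => i _; rewrite coef_map_id0 // -rmorphXn /=.
by case: (Q`_i) => x y /=; ring.
Qed.

(** For real [w] the conjugate of [i w] is [- i w], so the conjugate of [q(i w)] is a polynomial in
    [w]; real parts of coefficients then give real parts of values. *)
Definition re_dot (p q : {poly C}) : {poly R} := map_poly (@complex.Re R)
  ((p \Po (Complex 0 1 *: 'X)) * (map_poly conjc q \Po (Complex 0 (-1) *: 'X))).

Lemma conjc_iR (w : R) : conjc (Complex 0 w) = Complex 0 (-1) * w%:C%C.
Proof. by apply/eqP; rewrite eq_complex /=; apply/andP; split; apply/eqP; ring. Qed.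

Lemma horner_re_dot (p q : {poly C}) w :
  (re_dot p q).[w] = complex.Re (p.[Complex 0 w] * conjc q.[Complex 0 w]).
Proof.
rewrite horner_map_Re hornerM !horner_comp !hornerZ !hornerX -conjc_iR.
by rewrite (horner_map conjc); simpc.
Qed.

Lemma size_comp_scaleX (F : comNzRingType) (c : F) (p : {poly F}) :
  (size (p \Po (c *: 'X))%R <= size p)%N.
Proof. by apply/leq_sizeP => j pj; rewrite coef_comp_scaleX nth_default ?mul0r. Qed.

Lemma size_re_dot (p q : {poly C}) : (size (re_dot p q) <= (size p + size q).-1)%N.
Proof.
apply: leq_trans (size_poly _ _) _; apply: leq_trans (size_polyMleq _ _) _.
rewrite -!subn1 leq_sub2r // leq_add ?size_comp_scaleX //.
by apply: leq_trans (size_comp_scaleX _ _) (size_poly _ _).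
Qed.

Lemma coef_re_dot_top (p q : {poly C}) m k : (size p <= m.+1)%N -> (size q <= k.+1)%N ->
  (re_dot p q)`_(m + k) =
  complex.Re (p`_m * conjc q`_k * (Complex 0 1 ^+ m * Complex 0 (-1) ^+ k)).
Proof.
move=> sp sq; rewrite coef_map_id0 // coefM_top; first last.
- by apply: leq_trans (size_comp_scaleX _ _) _; apply: leq_trans (size_poly _ _) _.
- exact: leq_trans (size_comp_scaleX _ _) _.
by rewrite !coef_comp_scaleX coef_map_id0 ?conjc0 // mulrACA.
Qed.

Lemma mul_i_Ni : Complex 0 1 * Complex 0 (-1) = 1 :> C.
Proof. by simpc. Qed.

(** A negative leading coefficient would send [P] to minus infinity. When [N] exceeds the degree the
    coefficient is the default 0. *)
Lemma coef_ge0_of_horner_ge0 (P : {poly R}) N : (size P <= N.+1)%N ->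
  (forall w, 0 <= w -> 0 <= P.[w]) -> 0 <= P`_N.
Proof.
rewrite leq_eqVlt ltnS => /orP[/eqP sP|sP] P0; last by rewrite nth_default.
rewrite leNgt; apply/negP => PN; have [|k Hk] := @poly_pinfty_gt_lc _ (- P).
  by rewrite lead_coefN lead_coefE sP oppr_gt0.
have := Hk (Num.max k 0); rewrite le_max lexx => /(_ isT).
rewrite lead_coefN lead_coefE sP hornerN lerN2 /= => h.
by have := P0 (Num.max k 0); rewrite le_max lexx orbT => /(_ isT); lra.
Qed.

(* Multiplying by ['X^2] makes the two subleading coefficients available
   whatever the number of roots. *)
Lemma subleading_coefs (F : comNzRingType) (rs : seq F)
    (q := (\prod_(r <- rs) ('X - r%:P)) * 'X^2) :
  [/\ q`_(size rs).+2 = 1, q`_(size rs).+1 = - \sum_(r <- rs) r &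
      q`_(size rs) *+ 2 = (\sum_(r <- rs) r) ^+ 2 - \sum_(r <- rs) r ^+ 2].
Proof.
rewrite {}/q; elim: rs => [|r rs [IH2 IH1 IH0]] /=.
  by rewrite !big_nil mul1r !coefXn /= oppr0 expr0n addr0 mul0rn.
rewrite !big_cons -mulrA mulrBl !coefB !coefXM /= !mul_polyC !coefZ IH1 IH2.
split.
- rewrite [X in _ - _ * X]nth_default ?mulr0 ?subr0 //.
  apply: leq_trans (size_polyMleq _ _) _.
  rewrite size_prod_XsubC size_polyXn. by lia.
  by ring.
by rewrite mulrnBl IH0; ring.
Qed.

(** The cross terms are products of two negative numbers; the sign of the sum is carried along for
    the induction. *)
Lemma sumsq_le_sqrsum (rs : seq C) : (forall r, r \in rs -> complex.Re r < 0) ->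
  \sum_(r <- rs) complex.Re r ^+ 2 <= (\sum_(r <- rs) complex.Re r) ^+ 2 /\
  \sum_(r <- rs) complex.Re r <= 0.
Proof.
elim: rs => [|r rs IH] rs0; first by rewrite !big_nil expr0n.
have [|s2 s1] := IH; first by move=> s sin; apply: rs0; rewrite inE sin orbT.
have r0 := rs0 r (mem_head _ _); rewrite !big_cons; split; last lra.
nra.
Qed.

(** Sum [|r|^2 = 2 (Re r)^2 - Re (r^2)] over the roots: Newton's identity evaluates the last term,
    and stability bounds the sum of the [(Re r)^2] by the square of the sum. *)
Lemma stable_roots_bound (p : {poly C}) k : p \is monic -> stable p ->
  size p = k.+3 -> forall r, root p r ->
  normc r ^+ 2 <= 2 * complex.Re p`_k.+1 ^+ 2 - complex.Re (p`_k.+1 ^+ 2)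
                  + 2 * complex.Re p`_k.
Proof.
move=> p1 st sp r rp; have [rs prs rs0] := stable_factor p1 st.
have srs : size rs = k.+2 by apply: succn_inj; rewrite -sp prs size_prod_XsubC.
have [_] := subleading_coefs rs; rewrite -prs srs !coefMXn /= !subSS !subn0.
move=> ep1 ep2; rewrite prs root_prod_XsubC in rp.
have {ep2} ep2 : \sum_(r <- rs) r ^+ 2 = p`_k.+1 ^+ 2 - p`_k *+ 2.
  by rewrite ep2 ep1; ring.
have [s2 _] := sumsq_le_sqrsum rs0.
have ep1' : \sum_(r <- rs) complex.Re r = - complex.Re p`_k.+1.
  by rewrite ep1 raddfN /= opprK raddf_sum.
have nE (s : C) : normc s ^+ 2 = 2 * complex.Re s ^+ 2 - complex.Re (s ^+ 2).
  case: s => x y; rewrite /= sqr_sqrtr ?addr_ge0 ?sqr_ge0 //; ring.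
have : \sum_(r <- rs) normc r ^+ 2 =
    2 * \sum_(r <- rs) complex.Re r ^+ 2 - complex.Re (\sum_(r <- rs) r ^+ 2).
  rewrite raddf_sum /= mulr_sumr -sumrB; apply: eq_bigr => s _; exact: nE.
rewrite ep2 raddfB raddfMn /= => e.
have : normc r ^+ 2 <= \sum_(r <- rs) normc r ^+ 2.
  rewrite (big_rem r) //= lerDl sumr_ge0 // => s _; exact: sqr_ge0.
rewrite e ep1' sqrrN in s2 *; lra.
Qed.
End Parts.

(** * Weakly positive polynomials of low degree vanish *)

Section Key.
Variable R : realType.
Local Notation C := R[i].
Implicit Types (p h : {poly C}).

Lemma Re_mul_conj (z : C) : complex.Re (z * conjc z) = normc z ^+ 2.
Proof.
by case: z => x y; rewrite /= sqr_sqrtr ?addr_ge0 ?sqr_ge0 //; ring.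
Qed.

Lemma normc_gt0 (z : C) : (0 < normc z) = (z != 0).
Proof.
rewrite lt_neqAle normc_ge0 andbT eq_sym; congr negb; apply/eqP/eqP => [|->].
  exact: Normc.eq0_normc.
exact: Normc.normc0.
Qed.

Lemma Re_scale (t : R) (z : C) : complex.Re (t%:C%C * z) = t * complex.Re z.
Proof. by case: z => x y /=; ring. Qed.

Lemma stable_axis p w : stable p -> p.[Complex 0 w] != 0.
Proof. by move=> st; apply/negP => /st /=; rewrite ltxx. Qed.

(** For [0 <= l <= 1], [Re ((p + l h) conj p) >= |p|^2 > 0] on the axis, so the homotopy from [p] to
    [p + h] has no zero there. *)
Lemma stable_add p h : p \is monic -> stable p -> (size h < size p)%N ->
  (forall w, 0 <= complex.Re (h.[Complex 0 w] * conjc p.[Complex 0 w])) ->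
  stable (p + h).
Proof.
move=> p1 st sh ph; rewrite -[h]scale1r.
apply: (@stable_homotopy _ p h) => // [l l01 w|]; last by rewrite ler01 lexx.
rewrite hornerD hornerZ; apply/eqP => /(congr1 ( *%R^~ (conjc p.[Complex 0 w]))).
move=> /(congr1 (@complex.Re R)); rewrite mul0r mulrDl raddfD /= Re_mul_conj.
rewrite -mulrA Re_scale; apply/eqP; rewrite gt_eqF // ltr_pwDl //.
  by rewrite exprn_gt0 // normc_gt0 stable_axis.
by rewrite mulr_ge0 //; case/andP: l01.
Qed.

(* All the polynomials [p + t h], [t >= 0], are stable, and their first two
   subleading coefficients do not grow with [t]; so the sum of the [|r|^2]
   over their roots stays bounded, which is incompatible with [h != 0]. *)
Lemma weakly_positive_low_degree p h : p \is monic -> stable p ->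
  ((size h).+2 <= size p)%N ->
  (forall w, 0 <= complex.Re (h.[Complex 0 w] * conjc p.[Complex 0 w])) -> h = 0.
Proof.
move=> p1 st sh ph; have [->//|hn0] := eqVneq h 0.
have [k sp] : exists k, size p = k.+3.
  exists (size p - 3)%N; have : (0 < size h)%N by rewrite size_poly_gt0.
  lia.
have sh' : (size h <= k.+1)%N by rewrite -ltnS -ltnS -sp.
(* The coefficient of index [k + k.+2] in [re_dot h p] is [- Re h_k], since
   [i^k (-i)^(k+2) = -1]. *)
have hk : complex.Re h`_k <= 0.
  have : 0 <= (re_dot h p)`_(k + k.+2).
    apply: coef_ge0_of_horner_ge0 => [|w _]; last by rewrite horner_re_dot.
    by apply: leq_trans (size_re_dot _ _) _; lia.
  rewrite coef_re_dot_top ?sp //.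
  have -> : p`_k.+2 = 1 by move/monicP: p1; rewrite lead_coefE sp.
  have -> : Complex 0 1 ^+ k * Complex 0 (-1) ^+ k.+2 = -1 :> C.
    rewrite -(addn2 k) exprD mulrA -exprMn mul_i_Ni expr1n mul1r.
    by apply/eqP; rewrite eq_complex /=; apply/andP; split; apply/eqP; ring.
  by rewrite conjc1 mulr1 mulrN1 raddfN /= oppr_ge0.
apply: poly_vanish_nat => m; apply/eqP/negPn/negP; rewrite -normc_gt0 => hm.
set z : C := m%:R in hm.
pose M := 2 * complex.Re p`_k.+1 ^+ 2 - complex.Re (p`_k.+1 ^+ 2)
          + 2 * complex.Re p`_k.
have M0 : 0 <= 1 + `|M| by rewrite addr_ge0.
pose B := (normc z + (1 + `|M|)) ^+ k.+2.
have B0 : 0 <= B by rewrite exprn_ge0 // addr_ge0 // normc_ge0.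
(* This makes [|t h(z)| = |p(z)| + B + 1], whereas the root bound, uniform in [t], gives
   [|(p + t h)(z)| <= B]. *)
pose t := (normc p.[z] + B + 1) / normc h.[z].
have t0 : 0 <= t by rewrite divr_ge0 ?normc_ge0 // ?addr_ge0 ?normc_ge0.
have sth : (size (t%:C%C *: h)%R < size p)%N.
  exact: leq_ltn_trans (size_scale_leq _ _) (ltnW sh).
have stt : stable (p + t%:C%C *: h).
  apply: stable_add => // w; rewrite hornerZ -mulrA Re_scale mulr_ge0 //.
have mont := monic_addl p1 sth.
have spt : size (p + t%:C%C *: h) = k.+3 by rewrite size_polyDl.
have rb := stable_roots_bound mont stt spt.
have : normc (p + t%:C%C *: h).[z] <= B.
  have [rs prs] := monic_factor mont.
  have rbM r : r \in rs -> normc (z - r) <= normc z + (1 + `|M|).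
    move=> rin; have /rb : root (p + t%:C%C *: h) r by rewrite prs root_prod_XsubC.
    rewrite !coefD !coefZ [h`_k.+1]nth_default // mulr0 addr0.
    rewrite raddfD /= Re_scale => rM.
    have h1 : normc (z - r) <= normc z + normc r by rewrite -[normc r]normcN le_normcD.
    have h2 := ler_norm M; have h3 := normc_ge0 r.
    have h4 : t * complex.Re h`_k <= 0 by rewrite mulr_ge0_le0.
    have h5 : normc r ^+ 2 <= `|M| by apply: le_trans h2; rewrite /M; lra.
    by nra.
  have srs : size rs = k.+2 by apply: succn_inj; rewrite -spt prs size_prod_XsubC.
  rewrite prs horner_prodXsubC normc_prod /B -srs {prs rb spt srs}.
  elim: rs rbM => [|r rs IH] rbM; first by rewrite big_nil expr0.
  rewrite big_cons exprS ler_pM ?normc_ge0 //.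
  - by rewrite -normc_prod normc_ge0.
  - by rewrite rbM ?mem_head.
  by apply: IH => s sin; rewrite rbM // inE sin orbT.
have : normc (t%:C%C * h.[z]) <= normc (p + t%:C%C *: h).[z] + normc p.[z].
  rewrite -[normc p.[z]]normcN; apply: le_trans (le_normcD _ _).
  by rewrite hornerD hornerZ addrAC subrr add0r.
rewrite Normc.normcM normcR ger0_norm // /t mulfVK ?gt_eqF //.
by have := normc_ge0 p.[z]; lra.
Qed.
End Key.

(** * Weakly positive real functions *)

Section Boundary.
Variable R : realType.
Local Notation C := R[i].
Implicit Types (P Q : {poly R}).

Lemma horner_gt0_near P x : 0 < P.[x] ->
  exists2 d : R, 0 < d & forall y, `|y - x| < d -> 0 < P.[y].
Proof.
move=> Px; have [d d0 Hd] := poly_cont x P Px; exists d => // y /Hd.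
by rewrite ltr_norml => /andP[h _]; lra.
Qed.

(** By continuity; it allows cancelling a nonnegative factor that vanishes at [x]. *)
Lemma horner_ge0_except P x : (forall w, w != x -> 0 <= P.[w]) ->
  forall w, 0 <= P.[w].
Proof.
move=> P0 w; have [->|/P0//] := eqVneq w x; rewrite leNgt; apply/negP => Px.
have [|d d0 Hd] := @horner_gt0_near (- P) x; first by rewrite hornerN oppr_gt0.
have := Hd (x + d / 2); rewrite addrAC subrr add0r gtr0_norm ?divr_gt0 //.
move=> h; have {h} : 0 < (- P).[x + d / 2] by apply: h; lra.
by rewrite hornerN oppr_gt0 ltNge P0 //; apply/eqP => h; lra.
Qed.

(** Every root [x] is double: if the quotient by [X - x] did not vanish at [x], then [P] would
    change sign there. Dividing by the square keeps nonnegativity. *)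
Lemma count_roots_nonneg P (s : seq R) : P != 0 -> (forall w, 0 <= P.[w]) ->
  uniq s -> (forall x, x \in s -> root P x) -> ((size s).*2 < size P)%N.
Proof.
elim: s P => [|x s IH] P Pn0 P0 us rs; first by rewrite size_poly_gt0.
have /factor_theorem[Q PQ] := rs x (mem_head _ _).
have Pw w : P.[w] = Q.[w] * (w - x) by rewrite PQ hornerM hornerXsubC.
have Qx : root Q x.
  rewrite rootE; apply/negPn/negP; rewrite neq_lt => /orP[] Qx.
    have [|d d0 Hd] := @horner_gt0_near (- Q) x; first by rewrite hornerN oppr_gt0.
    have := Hd (x + d / 2); have := P0 (x + d / 2).
    rewrite Pw hornerN addrAC subrr add0r gtr0_norm ?divr_gt0 // => h1 h2.
    have {h2} h2 : 0 < - Q.[x + d / 2] by apply: h2; lra.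
    by rewrite pmulr_lge0 ?divr_gt0 // in h1; rewrite oppr_gt0 ltNge h1 in h2.
  have [d d0 Hd] := horner_gt0_near Qx.
  have := Hd (x - d / 2); have := P0 (x - d / 2).
  rewrite Pw addrAC subrr add0r normrN gtr0_norm ?divr_gt0 // => h1 h2.
  have {h2} h2 : 0 < Q.[x - d / 2] by apply: h2; lra.
  by rewrite mulrN oppr_ge0 pmulr_lle0 ?divr_gt0 // in h1; rewrite ltNge h1 in h2.
have /factor_theorem[Q2 QQ2] := Qx; case/andP: us => xs us.
have Pw2 w : P.[w] = Q2.[w] * (w - x) ^+ 2.
  by rewrite Pw QQ2 hornerM hornerXsubC expr2 mulrA.
have Q2n0 : Q2 != 0.
  by apply: contraNneq Pn0 => Q20; rewrite PQ QQ2 Q20 !mul0r.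
have sP : size P = (size Q2).+2.
  by rewrite PQ QQ2 !size_Mmonic ?monicXsubC ?mulf_neq0 ?polyXsubC_eq0 //
     !size_XsubC !addn2.
rewrite sP doubleS !ltnS; apply: IH => //.
  apply: (@horner_ge0_except _ x) => w wx; have := P0 w; rewrite Pw2.
  by rewrite pmulr_lge0 // exprn_even_gt0 //= subr_eq0.
move=> y yin; have : root P y by apply: rs; rewrite inE yin orbT.
rewrite !rootE Pw2 mulf_eq0 expf_eq0 subr_eq0 => /orP[//|/= /eqP yx].
by rewrite -yx yin in xs.
Qed.

(* On the imaginary axis [(s - z)(s + conj z) = - |s - z|^2]. *)
Lemma no_mirror_roots (p c : {poly C}) z : p \is monic -> stable p ->
  (size c <= size p)%N ->
  (forall w, 0 <= complex.Re (c.[Complex 0 w] * conjc p.[Complex 0 w])) ->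
  c != 0 -> ~~ (('X - z%:P) * ('X + (conjc z)%:P) %| c).
Proof.
move=> p1 st sc cp cn0; apply/negP => /dvdpP[c1 cE].
have c1n0 : c1 != 0 by apply: contraNneq cn0 => c10; rewrite cE c10 mul0r.
have sc1 : (size c1).+2 = size c.
  rewrite cE mulrA -[conjc z]opprK polyCN.
  by rewrite !size_Mmonic ?monicXsubC ?mulf_neq0 ?polyXsubC_eq0 // !size_XsubC !addn2.
(* Removing the factor [- |s - z|^2] leaves [- c1], still weakly positive but two degrees lower. *)
suff /eqP : - c1 = 0 by rewrite oppr_eq0 (negPf c1n0).
apply: (weakly_positive_low_degree p1 st); first by rewrite size_polyN sc1.
move=> w; rewrite -horner_re_dot.
apply: (@horner_ge0_except _ (complex.Im z)) => {}w wz.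
have := cp w; rewrite horner_re_dot cE hornerN !hornerM !hornerD hornerN !hornerX !hornerC.
have zE : Complex 0 w + conjc z = - conjc (Complex 0 w - z).
  by case: z {cE wz} => x y; apply/eqP; rewrite eq_complex /=; apply/andP; split; apply/eqP; ring.
have -> : c1.[Complex 0 w] * ((Complex 0 w - z) * (Complex 0 w + conjc z)) * conjc p.[Complex 0 w]
   = ((Complex 0 w - z) * conjc (Complex 0 w - z)) * (- c1.[Complex 0 w] * conjc p.[Complex 0 w]).
  by rewrite zE; ring.
rewrite -sqr_normc normc_def -rmorphXn /= Re_scale pmulr_rge0 //.
rewrite sqr_sqrtr ?addr_ge0 ?sqr_ge0 // ltr_wpDl ?sqr_ge0 //.
rewrite exprn_even_gt0 //=; apply: contra_neq wz; case: z {cE zE} => x y /= h; lra.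
Qed.

Lemma size_cpoly (p : {poly R}) : size (cpoly p) = size p.
Proof. exact: size_map_poly. Qed.

Lemma coef_cpoly (p : {poly R}) k : (cpoly p)`_k = (p`_k)%:C%C.
Proof. exact: coef_map. Qed.

Lemma cpoly_monic (p : {poly R}) : p \is monic -> cpoly p \is monic.
Proof. by rewrite map_monic. Qed.

(* Otherwise [a + t c] would be stable for all real [t], hence without
   nonnegative real root. *)
Lemma re_dot_eq0 (a c : {poly R}) : a \is monic -> hurwitz a ->
  (size c <= size a)%N -> re_dot (cpoly c) (cpoly a) = 0 -> c = 0.
Proof.
move=> a1 st sc ca; have [n sa] : exists n, size a = n.+1.
  by exists (size a).-1; rewrite prednK // size_poly_gt0 monic_neq0.
(* The coefficient of index [n + n] in [re_dot] is [c_n], because [a] is monic and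
   [i^n (-i)^n = 1]. *)
have sc' : (size c < size a)%N.
  rewrite sa in sc *; rewrite ltn_neqAle sc andbT; apply/eqP => scE.
  have : (re_dot (cpoly c) (cpoly a))`_(n + n) = 0 by rewrite ca coef0.
  rewrite coef_re_dot_top ?size_cpoly ?sa // -exprMn mul_i_Ni expr1n mulr1.
  rewrite !coef_cpoly (_ : a`_n = 1) ?conjc1 ?mulr1 /=; last first.
    by move/monicP: a1; rewrite lead_coefE sa.
  move=> cn; have : lead_coef c == 0 by rewrite lead_coefE scE cn.
  by rewrite lead_coef_eq0 => /eqP c0; rewrite c0 size_poly0 in scE.
apply: poly_vanish_nat => k; apply/eqP/negPn/negP => ck.
pose t := - (a.[k%:R] / c.[k%:R]).
have stt : stable (cpoly a + cpoly (t *: c)).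
  apply: stable_add; rewrite ?cpoly_monic ?size_cpoly //.
    exact: leq_ltn_trans (size_scale_leq _ _) sc'.
  move=> w; rewrite /cpoly map_polyZ hornerZ -mulrA Re_scale -horner_re_dot.
  by rewrite ca horner0 mulr0.
suff /stt : root (cpoly a + cpoly (t *: c)) (k%:R)%:C%C by rewrite /= ltNge ler0n.
rewrite rootE hornerD /cpoly !(horner_map (real_complex R)) hornerZ mulNr divfK //.
by rewrite rmorphN addrN.
Qed.
End Boundary.

(** * Interpolation on the imaginary axis *)

Section Axis.
Variable R : realType.
Local Notation C := R[i].
Implicit Types (p q c e T : {poly R}).

(** On the axis this is complex conjugation of the values of [p], which makes conjugation accessible
    to gcd and Bezout arguments. *)
Definition mirror p := p \Po (- 'X).
Definition axis p (w : R) : C := (cpoly p).[Complex 0 w].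

Lemma axisD p q w : axis (p + q) w = axis p w + axis q w.
Proof. by rewrite /axis /cpoly rmorphD hornerD. Qed.

Lemma axisB p q w : axis (p - q) w = axis p w - axis q w.
Proof. by rewrite /axis /cpoly rmorphB hornerD hornerN. Qed.

Lemma axisM p q w : axis (p * q) w = axis p w * axis q w.
Proof. by rewrite /axis /cpoly rmorphM hornerM. Qed.

Lemma axis_mirror p w : axis (mirror p) w = conjc (axis p w).
Proof.
rewrite /axis /mirror -(horner_map conjc) /= -map_poly_comp /=.
rewrite (eq_map_poly (g := real_complex R)); last exact: conjc_real.
by rewrite /cpoly map_comp_poly rmorphN /= map_polyX horner_comp hornerN hornerX; simpc.
Qed.

Lemma axisN p w : axis p (- w) = conjc (axis p w).
Proof.
rewrite -axis_mirror /axis /mirror /cpoly map_comp_poly rmorphN /= map_polyX.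
by rewrite horner_comp hornerN hornerX; simpc.
Qed.

Lemma exp_axis (w : R) k : Complex 0 w ^+ k =
  Complex ((~~ odd k)%:R * (-1) ^+ k./2 * w ^+ k) ((odd k)%:R * (-1) ^+ k./2 * w ^+ k).
Proof.
elim: k => [|k IH]; first by rewrite !expr0 /= !mul1r !mul0r.
rewrite exprS IH /= uphalf_half; case: (odd k) => /=;
  by apply/eqP; rewrite eq_complex /= ?exprS ?exprD /=; apply/andP; split; apply/eqP; ring.
Qed.

(* [Re + Im] of [twist p] at [i w] is [p.[w]], and [Re], [Im] are even, odd in
   [w]: interpolating conjugation-invariant data on the axis reduces to
   interpolating a real function of [w]. *)
Definition twist p : {poly R} := \poly_(i < size p) ((-1) ^+ i./2 * p`_i).

Lemma axis_twist p w : axis (twist p) w =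
  Complex ((p.[w] + p.[- w]) / 2) ((p.[w] - p.[- w]) / 2).
Proof.
have sgn k : (-1) ^+ k * (-1) ^+ k = 1 :> R by rewrite -exprMn mulrNN mul1r expr1n.
rewrite /axis (@horner_coef_wide _ (size p)); last by rewrite size_cpoly size_poly.
rewrite !horner_coef -big_split -sumrB /= !mulr_suml.
apply/eqP; rewrite eq_complex /= !raddf_sum /=; apply/andP; split; apply/eqP;
  apply: eq_bigr => k _; rewrite coef_cpoly coef_poly ltn_ord exp_axis;
  rewrite (exprNn w) -(signr_odd _ k); move: (sgn k./2); case: (odd k) => /= h;
  rewrite ?expr0 ?expr1; have {h} := congr1 ( *%R (p`_k * w ^+ k)) h; lra.
Qed.

Lemma interpolation (F : fieldType) (s : seq F) (f : F -> F) : uniq s ->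
  exists2 p : {poly F}, (size p <= size s)%N & forall x, x \in s -> p.[x] = f x.
Proof.
elim: s => [_|x s IH /andP[xs us]]; first by exists 0; rewrite ?size_poly0.
have [p sp pf] := IH us; pose q := \prod_(y <- s) ('X - y%:P).
have qx : q.[x] != 0 by rewrite -rootE root_prod_XsubC.
exists (p + ((f x - p.[x]) / q.[x]) *: q) => [|y].
  rewrite (leq_trans (size_polyD _ _)) // geq_max (leq_trans sp) //=.
  by rewrite (leq_trans (size_scale_leq _ _)) // size_prod_XsubC.
rewrite inE hornerD hornerZ => /orP[/eqP->|ys]; first by rewrite divfK // addrC subrK.
have /rootP-> : root q y by rewrite root_prod_XsubC.
by rewrite mulr0 addr0 pf.
Qed.

Lemma axis_interpolation (s : seq R) (v : R -> C) : uniq s ->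
  (forall w, w \in s -> - w \in s) -> (forall w, v (- w) = conjc (v w)) ->
  exists2 p : {poly R}, (size p <= size s)%N & forall w, w \in s -> axis p w = v w.
Proof.
move=> us ss vJ.
have [p sp pv] := interpolation (fun w => complex.Re (v w) + complex.Im (v w)) us.
exists (twist p) => [|w ws]; first exact: leq_trans (size_poly _ _) sp.
rewrite axis_twist !pv ?ss // vJ; case: (v w) => x y /=.
by apply/eqP; rewrite eq_complex /=; apply/andP; split; apply/eqP; field.
Qed.

(** Write [T = e q + mirror e * c1] with [c1] reduced modulo [e]; the bound on [T] then bounds [q].
    On the axis [Im (e q) = - Im (conj e conj q)], so [c1 - mirror q] has the required imaginary
    part. *)
Lemma axis_bezout e T : coprimep e (mirror e) -> (size T <= (size e).-1.*2)%N ->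
  exists2 c : {poly R}, (size c <= (size e).-1)%N &
    forall w, complex.Im (axis c w * conjc (axis e w)) = complex.Im (axis T w).
Proof.
move=> /Bezout_eq1_coprimepP[[u1 u2] /= u12] sT.
have en0 : e != 0.
  apply: contra_eq_neq u12 => ->; rewrite /mirror comp_poly0 !mulr0 addr0.
  by rewrite eq_sym oner_neq0.
pose c1 := (T * u2) %% e.
pose q := T * u1 + ((T * u2) %/ e) * mirror e.
have TE : T = e * q + mirror e * c1.
  rewrite -[LHS]mulr1 -u12 mulrDr !mulrA {1}(divp_eq (T * u2) e) /q /c1; ring.
have se : (0 < size e)%N by rewrite size_poly_gt0.
have sc1 : (size c1 <= (size e).-1)%N.
  by rewrite -ltnS prednK // ltn_modp.
have sm : (size (mirror e) <= size e)%N.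
  by rewrite /mirror size_comp_poly2 // size_polyN size_polyX.
have sq : (size q <= (size e).-1)%N.
  have [->|qn0] := eqVneq q 0; first by rewrite size_poly0.
  have : (size (e * q)%R <= (size e).-1.*2)%N.
    have -> : e * q = T - mirror e * c1 by rewrite [in RHS]TE; ring.
    rewrite (leq_trans (size_polyD _ _)) // geq_max sT size_polyN.
    apply: leq_trans (size_polyMleq _ _) _; move: sm sc1; clearbody c1.
    by move: (size (mirror e)) (size e) (size c1) se => x y z; lia.
  rewrite size_mul //; clearbody q.
  by move: (size q) (size e) se => x y; lia.
exists (c1 - mirror q).
  rewrite (leq_trans (size_polyD _ _)) // geq_max sc1 size_polyN.
  by rewrite /mirror size_comp_poly2 // size_polyN size_polyX.
move=> w; rewrite TE axisB axisD !axisM !axis_mirror.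
case: (axis e w) (axis c1 w) (axis q w) => [x1 y1] [x2 y2] [x3 y3] /=; ring.
Qed.

(** The gcd [g] is proportional to its own mirror, so the mirror of [c %/ g] is, up to a constant,
    the cofactor of [g] in [mirror c]. *)
Lemma coprimep_mirror_gcd c (g := gcdp c (mirror c)) :
  c != 0 -> coprimep (c %/ g) (mirror (c %/ g)).
Proof.
move=> cn0.
have mirrorK p : mirror (mirror p) = p.
  by rewrite /mirror -comp_polyA raddfN /= comp_polyX opprK comp_polyXr.
have gn0 : g != 0 by rewrite gcdp_eq0 (negPf cn0).
have cE : c = c %/ g * g by rewrite divpK ?dvdp_gcdl.
have /eqpP[[k l] /= /andP[kn0 ln0] kl] : mirror g %= g.
  rewrite /g /mirror (eqp_trans (gcdp_comp_poly _ _ _)) //.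
  by rewrite -/(mirror _) -/(mirror (mirror c)) mirrorK gcdpC.
have gE : mirror g = (l / k) *: g.
  by apply: (scalerI kn0); rewrite kl scalerA mulrC divfK.
have := coprimep_div_gcd (p := c) (q := mirror c); rewrite cn0 => /(_ isT).
rewrite -/g {2}cE /mirror comp_polyM -/(mirror _) -/(mirror g) gE.
by rewrite -scalerAr divpZl mulpK // coprimepZr // mulf_neq0 ?invr_eq0.
Qed.

End Axis.

(** * The improving direction *)

Section Improve.
Variable R : realType.
Local Notation C := R[i].

Lemma uniq_of_squarefree (rs : seq C) :
  (forall r, r \in rs ->
     ~~ (('X - r%:P) * ('X - r%:P) %| \prod_(s <- rs) ('X - s%:P))) -> uniq rs.
Proof.
elim: rs => //= r rs IH sqf; apply/andP; split.
  apply/negP => rin; have /negP[] := sqf r (mem_head _ _).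
  by rewrite big_cons dvdp_mul2l ?polyXsubC_eq0 // dvdp_XsubCl root_prod_XsubC.
apply: IH => s sin; have : s \in r :: rs by rewrite inE sin orbT.
by move=> /sqf; apply: contra; rewrite big_cons; apply: dvdp_mull.
Qed.

(** A root [r] of [g] makes [r] and [- r] roots of [c], hence also [- conj r] as [c] is real. If
    [Re r] is nonzero this is a pair forbidden by [no_mirror_roots]; a double imaginary root is such
    a pair with both members equal. *)
Lemma boundary_factor (a c : {poly R}) : a \is monic -> hurwitz a ->
  (size c <= size a)%N -> c != 0 ->
  (forall w, 0 <= complex.Re (axis c w * conjc (axis a w))) ->
  exists (g e : {poly R}) (ws : seq R),
  [/\ [/\ c = g * e, coprimep e (mirror e) & uniq ws], size g = (size ws).+1,
      forall w, w \in ws -> axis g w = 0 & forall w, (axis c w == 0) = (w \in ws)].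
Proof.
move=> a1 st sc cn0 ca.
pose g := gcdp c (mirror c); have gn0 : g != 0 by rewrite gcdp_eq0 (negPf cn0).
have cE : c = g * (c %/ g) by rewrite mulrC divpK ?dvdp_gcdl.
have gC : cpoly g %= gcdp (cpoly c) (cpoly (mirror c)).
  by rewrite -gcdp_map eqpxx.
have Cn0 : cpoly g != 0 by rewrite /cpoly map_poly_eq0.
have [rs gE] := closed_field_poly_normal (cpoly g).
have ln0 : lead_coef (cpoly g) != 0 by rewrite lead_coef_eq0.
have rootg r : root (cpoly g) r = (r \in rs) by rewrite gE rootZ // root_prod_XsubC.
have mirr z : root (cpoly (mirror c)) z = root (cpoly c) (- z).
  by rewrite /root /mirror /cpoly map_comp_poly rmorphN /= map_polyX horner_comp hornerN hornerX.
have conjr z : root (cpoly c) (conjc z) = root (cpoly c) z.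
  rewrite -complex_root_conj; congr (root _ z); rewrite /cpoly -map_poly_comp.
  by apply: eq_map_poly => x; exact: conjc_real.
have rootg' r : root (cpoly g) r = root (cpoly c) r && root (cpoly c) (- r).
  by rewrite (eqp_root gC) root_gcd mirr.
have nomir z : ~~ (('X - z%:P) * ('X + (conjc z)%:P) %| cpoly c).
  apply: (@no_mirror_roots _ (cpoly a)); rewrite ?cpoly_monic ?size_cpoly //.
  by rewrite /cpoly map_poly_eq0.
have Re0 r : r \in rs -> complex.Re r = 0.
  rewrite -rootg rootg' => /andP[r1 r2]; apply/eqP/negPn/negP => rn0.
  have /negP[] := nomir r; rewrite -[conjc r]opprK polyCN.
  rewrite Gauss_dvdp; first by rewrite !dvdp_XsubCl r1 -(raddfN conjc) conjr.
  rewrite coprimep_XsubC root_XsubC; apply: contraNneq rn0.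
  by case: r {r1 r2} => x y /= [h _]; apply/eqP; lra.
have RIm r : r \in rs -> r = Complex 0 (complex.Im r).
  by move=> /Re0; case: r => x y /= ->.
have urs : uniq rs.
  apply: uniq_of_squarefree => r rin; apply/negP => h; have /negP[] := nomir r.
  have -> : 'X + (conjc r)%:P = 'X - r%:P :> {poly C}.
    by rewrite (RIm r rin) -polyCN; congr (_ + _%:P); simpc.
  have : cpoly g %| cpoly c by rewrite (eqp_dvdl _ gC) dvdp_gcdl.
  by apply: dvdp_trans; rewrite gE dvdpZr.
exists g, (c %/ g), [seq complex.Im r | r <- rs]; split.
- split=> //; first exact: coprimep_mirror_gcd.
  rewrite map_inj_in_uniq // => r s rin sin rs'.
  by rewrite (RIm r rin) (RIm s sin) rs'.
- by rewrite -size_cpoly gE size_scale // size_prod_XsubC size_map.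
- move=> w /mapP[r rin ->]; rewrite /axis -RIm //.
  by apply/rootP; rewrite rootg.
move=> w; apply/idP/idP => [cw|/mapP[r rin ->]].
  apply/mapP; exists (Complex 0 w) => //; rewrite -rootg rootg' {1}/root cw /=.
  by rewrite -conjr; have -> : conjc (- Complex 0 w) = Complex 0 w by rewrite /= oppr0 opprK.
by rewrite /axis -RIm //; have := rin; rewrite -rootg rootg' => /andP[].
Qed.

(** The condition on [Im] says that [d] is a real multiple of [z], so it inherits orthogonality to
    [y]. *)
Lemma Re_transfer (d z y : C) : z != 0 -> complex.Re (z * conjc y) = 0 ->
  complex.Im (d * conjc z) = 0 -> complex.Re (d * conjc y) = 0.
Proof.
move=> zn0 zy dz; have : 0 < normc z ^+ 2 by rewrite exprn_gt0 // normc_gt0.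
rewrite -Re_mul_conj => z0; apply: (mulfI (lt0r_neq0 z0)); rewrite mulr0.
case: d z y {zn0 z0} zy dz => [d1 d2] [z1 z2] [y1 y2] /= zy dz.
transitivity ((d1 * z1 - d2 * - z2) * (z1 * y1 - z2 * - y2) -
              (d1 * - z2 + d2 * z1) * (z1 * - y2 + z2 * y1)); first by ring.
by rewrite zy dz; ring.
Qed.

(** The zeros of [re_dot] are double and include [ws], so twice their number is less than
    [size c + n], which is at most twice [size c]. *)
Lemma zeros_re_dot_bound (a c : {poly R}) (ws : seq R) n :
  a \is monic -> hurwitz a -> size a = n.+1 -> (size c <= n.+1)%N -> c != 0 ->
  (forall w, 0 <= complex.Re (axis c w * conjc (axis a w))) ->
  (n <= size c)%N -> uniq ws -> (forall w, (axis c w == 0) = (w \in ws)) ->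
  exists2 s : seq R, (size s + size ws < size c)%N &
    forall w, (w \in s) =
      (complex.Re (axis c w * conjc (axis a w)) == 0) && (w \notin ws).
Proof.
move=> a1 st sa sc cn0 ca nc uws wsP; set P := re_dot (cpoly c) (cpoly a).
have Pn0 : P != 0.
  by apply: contra_neq cn0 => P0; apply: (re_dot_eq0 a1 st) => //; rewrite sa.
have mem w : (w \in rootsR P) = root P w.
  by rewrite -(roots_on_rootsR Pn0) inE.
exists [seq w <- rootsR P | w \notin ws]; last first.
  by move=> w; rewrite mem_filter mem andbC rootE horner_re_dot.
have bound : ((size ([seq w <- rootsR P | w \notin ws] ++ ws)).*2 < size P)%N.
  apply: count_roots_nonneg => // [w||w].
  - by rewrite horner_re_dot; exact: ca.
  - rewrite cat_uniq filter_uniq ?uniq_roots //= uws andbT.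
    by apply/hasPn => w win; rewrite mem_filter win.
  rewrite mem_cat mem_filter mem => /orP[/andP[]//|]; rewrite -wsP => /eqP cw.
  by rewrite rootE horner_re_dot [_.[_]]cw mul0r.
have := leq_trans bound (size_re_dot _ _).
rewrite size_cat !size_cpoly sa.
move: (size (seq.filter _ _)) (size ws) (size c) sc nc => x y z; lia.
Qed.

Lemma Re_conjM (x y : C) : complex.Re (conjc x * conjc (conjc y)) = complex.Re (x * conjc y).
Proof. by case: x y => [x1 x2] [y1 y2] /=; ring. Qed.

(** [d] equals [v] at the zeros of [c] on the axis; at the other zeros of the two real parts,
    [d - v] is a real multiple of [c], hence orthogonal to [a] or [b] there. Either way [d] inherits
    the positivity of [v]. *)
Lemma improving_direction (a b c : {poly R}) n (v : R -> C) :
  a \is monic -> hurwitz a -> size a = n.+1 ->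
  b \is monic -> hurwitz b -> size b = n.+1 ->
  (size c <= n.+1)%N -> c != 0 ->
  (forall w, 0 <= complex.Re (axis c w * conjc (axis a w))) ->
  (forall w, 0 <= complex.Re (axis c w * conjc (axis b w))) ->
  (forall w, v (- w) = conjc (v w)) ->
  (forall w, 0 < complex.Re (v w * conjc (axis a w))) ->
  (forall w, 0 < complex.Re (v w * conjc (axis b w))) ->
  exists d : {poly R}, [/\ (size d <= n.+1)%N,
    forall w, complex.Re (axis c w * conjc (axis a w)) = 0 ->
      0 < complex.Re (axis d w * conjc (axis a w)),
    forall w, complex.Re (axis c w * conjc (axis b w)) = 0 ->
      0 < complex.Re (axis d w * conjc (axis b w)) &
    c`_n = 0 -> 0 < d`_n].
Proof.
move=> a1 sta sa b1 stb sb sc cn0 ca cb vJ va vb.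
(* Otherwise [c] is at least two degrees below [a] and vanishes. *)
have nc : (n <= size c)%N.
  rewrite leqNgt; apply/negP => sc'; have /eqP := cn0; apply.
  apply/eqP; rewrite -(map_poly_eq0 (real_complex R)); apply/eqP.
  apply: (@weakly_positive_low_degree _ (cpoly a)); rewrite ?cpoly_monic ?size_cpoly ?sa //.
have ca' : (size c <= size a)%N by rewrite sa.
have [g [e [ws [[cE eco uws] sg gws wsP]]]] := boundary_factor a1 sta ca' cn0 ca.
have [sA szA sAP] := zeros_re_dot_bound a1 sta sa sc cn0 ca nc uws wsP.
have [sB szB sBP] := zeros_re_dot_bound b1 stb sb sc cn0 cb nc uws wsP.
have [gn0 en0] : g != 0 /\ e != 0 by apply/andP; rewrite -negb_or -mulf_eq0 -cE.
have szc : size c = (size ws + size e)%N by rewrite cE size_mul // sg.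
have se : (0 < size e)%N by rewrite size_poly_gt0.
(* [c] may lose one degree; then infinity is a zero too and [d] must be monic. *)
pose delta : {poly R} := if size c == n.+1 then 0 else 'X^n.
have sdelta : (size delta <= n.+1)%N.
  by rewrite /delta; case: ifP; rewrite ?size_poly0 ?size_polyXn.
have wsN w : w \in ws -> - w \in ws by rewrite -!wsP axisN conjc_eq0.
have [|u su uP] := @axis_interpolation R ws (fun w => v w - axis delta w) uws wsN.
  by move=> w; rewrite vJ axisN rmorphB.
(* [base] already has the values [v] on [ws]; adding a multiple of [g] does not disturb them. *)
pose base := delta + u.
have basews w : w \in ws -> axis base w = v w.
  by move=> win; rewrite axisD uP // addrC subrK.
pose s := undup (sA ++ sB).
have sP w : w \in s = (w \in sA) || (w \in sB) by rewrite mem_undup mem_cat.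
have sN w : w \in s -> - w \in s.
  by rewrite !sP !sAP !sBP -!wsP !axisN !Re_conjM conjc_eq0.
(* With [c = g e] and [d = base + g c'], [Im ((d - base) conj c) = |g|^2 Im (c' conj e)]; hence the
   division by [|g|^2]. *)
pose t w := Complex 0 (complex.Im ((v w - axis base w) * conjc (axis c w))
                       / normc (axis g w) ^+ 2).
have [|T sT TP] := @axis_interpolation R s t (undup_uniq _) sN.
  move=> w; rewrite /t vJ !axisN.
  have -> : normc (conjc (axis g w)) = normc (axis g w).
    by case: (axis g w) => x y /=; rewrite sqrrN.
  case: (v w) (axis base w) (axis c w) => [x1 y1] [x2 y2] [x3 y3] /=.
  by congr Complex; rewrite ?oppr0 //; ring.
(* As [size c = size ws + size e], each of [sA] and [sB] has at most [(size e).-1] points, just what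
   the Bezout step allows. *)
have [|c' sc' c'P] := @axis_bezout _ e T eco.
  apply: leq_trans sT _; apply: leq_trans (size_undup _) _; rewrite size_cat.
  move: szA szB se; rewrite szc; move: (size sA) (size sB) (size ws) (size e) => x y z k.
  lia.
have sgc : (size (g * c')%R <= n)%N.
  apply: leq_trans (size_polyMleq _ _) _; rewrite sg.
  move: sc se sc'; rewrite szc; move: (size ws) (size e) (size c') => x y z; lia.
have su' : (size u <= n)%N.
  apply: leq_trans su _; move: sc se; rewrite szc; move: (size ws) (size e) => x y; lia.
pose d := base + g * c'.
have dP w : axis c w = 0 \/ w \in s ->
    axis d w = v w \/ axis c w != 0 /\ complex.Im ((axis d w - v w) * conjc (axis c w)) = 0.
  have [/eqP cw|cw] := boolP (axis c w == 0).
    left; rewrite axisD axisM gws ?mul0r ?addr0 ?basews // -wsP; exact/eqP.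
  case=> [/eqP|ws']; [by rewrite (negPf cw)|right; split=> //].
  have gw : 0 < normc (axis g w) ^+ 2.
    rewrite exprn_gt0 // normc_gt0; apply: contraNneq cw => gw.
    by rewrite cE axisM gw mul0r.
  have := c'P w; rewrite TP // /t /=.
  set I := complex.Im (_ * conjc (axis c w)) => h.
  have {h} : normc (axis g w) ^+ 2 * complex.Im (axis c' w * conjc (axis e w)) = I.
    by rewrite h mulrC divfK // gt_eqF.
  have dE : axis d w = axis base w + axis g w * axis c' w by rewrite [LHS]axisD axisM.
  have cEw : axis c w = axis g w * axis e w by rewrite {1}cE axisM.
  rewrite -Re_mul_conj /I dE cEw.
  case: (axis g w) (axis c' w) (axis e w) (v w) (axis base w)
    => [x1 y1] [x2 y2] [x3 y3] [x4 y4] [x5 y5] /= h.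
  by apply: etrans (subrr (x1 * x1)); lra.
have dlast y w : (axis c w = 0 \/ w \in s) -> complex.Re (axis c w * conjc y) = 0 ->
    0 < complex.Re (v w * conjc y) -> 0 < complex.Re (axis d w * conjc y).
  move=> /dP[-> //|[cw dv]] cy; have := Re_transfer cw cy dv.
  by rewrite mulrBl raddfB /= => /eqP; rewrite subr_eq0 => /eqP ->.
exists d; split.
- apply: leq_trans (size_polyD _ _) _; rewrite geq_max [X in _ && X]leqW // andbT.
  by apply: leq_trans (size_polyD _ _) _; rewrite geq_max sdelta leqW.
- move=> w cw; apply: dlast => //.
  have [cw0|cw0] := eqVneq (axis c w) 0; [by left|right].
  by rewrite sP sAP cw eqxx -wsP cw0.
- move=> w cw; apply: dlast => //.
  have [cw0|cw0] := eqVneq (axis c w) 0; [by left|right].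
  by rewrite sP sBP cw eqxx -wsP cw0 orbT.
move=> cn; rewrite !coefD [u`_n]nth_default // [(g * c')`_n]nth_default // !addr0.
rewrite /delta; case: eqP => [sc1|_]; last by rewrite coefXn eqxx.
by have := lead_coef_eq0 c; rewrite lead_coefE sc1 /= cn eqxx (negPf cn0).
Qed.

End Improve.

(** * Uniform perturbation *)

Section Perturb.
Variable R : realType.
Implicit Types (P D : {poly R}).

(* The value at [y = w / (1 + w)] is [P.[w]] up to a positive factor; the point at
   infinity becomes [y = 1]. *)
Definition homogenize N P : {poly R} := \sum_(i < N.+1) P`_i *: ('X^i * (1 - 'X) ^+ (N - i)).

Lemma homogenize1 N P : (homogenize N P).[1] = P`_N.
Proof.
rewrite horner_sum big_ord_recr big1 /= ?add0r => [|i _].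
  by rewrite subnn expr0 mulr1 hornerZ hornerXn expr1n mulr1.
rewrite hornerZ hornerM hornerXn horner_exp hornerD hornerN hornerX hornerC subrr.
by rewrite expr0n subn_eq0 leqNgt ltn_ord /= !mulr0.
Qed.

Lemma homogenizeE N P w : 0 <= w -> (size P <= N.+1)%N ->
  (homogenize N P).[w / (1 + w)] * (1 + w) ^+ N = P.[w].
Proof.
move=> w0 sP; have w1 : 1 + w != 0 by apply/eqP; lra.
rewrite horner_sum mulr_suml (horner_coef_wide w sP); apply: eq_bigr => i _.
rewrite hornerZ hornerM hornerXn horner_exp hornerD hornerN hornerX hornerC -mulrA.
congr (_ * _); have -> : 1 - w / (1 + w) = (1 + w)^-1 by field.
have -> : (1 + w) ^+ N = (1 + w) ^+ i * (1 + w) ^+ (N - i).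
  by rewrite -exprD subnKC // -ltnS.
by rewrite exprMn !exprVn; field; rewrite !expf_neq0.
Qed.

(** After homogenization to the compact [[0, 1]], [max f g] has a positive minimum [h]. Where
    [f >= h] a small [t] cannot spoil positivity; elsewhere [g >= h] and [f >= 0]. *)
Lemma uniform_perturbation P D N :
  (size P <= N.+1)%N -> (size D <= N.+1)%N ->
  (forall w : R, 0 <= w -> 0 <= P.[w]) ->
  (forall w : R, 0 <= w -> P.[w] = 0 -> 0 < D.[w]) -> (P`_N = 0 -> 0 < D`_N) ->
  exists2 e : R, 0 < e & forall t : R, 0 < t <= e ->
    (forall w : R, 0 <= w -> 0 < P.[w] + t * D.[w]) /\ 0 < P`_N + t * D`_N.
Proof.
move=> sP sD P0 PD PDN; pose f := homogenize N P; pose g := homogenize N D.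
have cases (y : R) : 0 <= y <= 1 -> y = 1 \/
    exists2 w : R, 0 <= w & y = w / (1 + w).
  move=> y01; have [->|y1] := eqVneq y 1; [by left|right].
  have {}y1 : y < 1 by rewrite lt_neqAle y1; case/andP: y01.
  exists (y / (1 - y)); first by case/andP: y01 => y0 _; apply: divr_ge0 => //; lra.
  by field; apply/andP; split; apply/eqP; lra.
have fg (y : R) : 0 <= y <= 1 -> 0 <= f.[y] /\ (f.[y] = 0 -> 0 < g.[y]).
  case/cases => [->|[w w0 ->]].
    by rewrite !homogenize1; split => //; exact: coef_ge0_of_horner_ge0.
  have wN : 0 < (1 + w) ^+ N by rewrite exprn_gt0; lra.
  split; first by rewrite -(pmulr_lge0 _ wN) homogenizeE ?P0.
  move=> fw; rewrite -(pmulr_lgt0 _ wN) homogenizeE //; apply: PD => //.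
  by rewrite -(homogenizeE w0 sP) [X in X * _]fw mul0r.
have [c c01 cmin] := @EVT_min R (fun y => Num.max f.[y] g.[y]) 0 1 ler01
  (continuous_subspaceT (fun x => continuous_max (@continuous_horner R f x) (@continuous_horner R g x))).
have [m m01 mmax] := @EVT_max R (fun y => `|g.[y]|) 0 1 ler01
  (continuous_subspaceT (fun x => continuous_comp (@continuous_horner R g x) (@norm_continuous _ _ _))).
pose h := Num.max f.[c] g.[c]; pose M := `|g.[m]|.
have h0 : 0 < h.
  rewrite /h lt_max; rewrite in_itv /= in c01; have [f0 fg0] := fg c c01.
  by move: f0; rewrite le_eqVlt => /orP[/eqP/esym/fg0 ->|->]; rewrite ?orbT.
have M0 : 0 <= M by rewrite normr_ge0.
(* So that [t M <= h / 2]; the [+ 1] covers [M = 0]. *)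
exists (h / (M + 1) / 2); first by rewrite !divr_gt0 //; lra.
move=> t /andP[t0 te].
have pos (y : R) : 0 <= y <= 1 -> 0 < f.[y] + t * g.[y].
  move=> y01; have [f0 _] := fg y y01.
  have := cmin y; rewrite in_itv /= => /(_ y01); rewrite -/h le_max => /orP[hf|hg].
    have := mmax y; rewrite in_itv /= => /(_ y01); rewrite -/M => gM.
    have : t * (M + 1) <= h / 2.
      by rewrite -ler_pdivlMr; [rewrite mulrAC|lra].
    have : - M <= g.[y] by have := lerNnormlW gM; lra.
    by nra.
  have : 0 < t * g.[y] by rewrite mulr_gt0 //; lra.
  by lra.
split=> [w w0|]; last by have := pos 1; rewrite !homogenize1; apply; rewrite ler01 lexx.
have wN : 0 < (1 + w) ^+ N by rewrite exprn_gt0; lra.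
rewrite -(homogenizeE w0 sP) -(homogenizeE w0 sD) mulrA -mulrDl mulr_gt0 // pos //.
by apply/andP; split; [apply: divr_ge0 => //|rewrite ler_pdivrMr]; lra.
Qed.
End Perturb.

(** * Cones of SPR numerators *)

Section Cones.
Variable R : realType.
Local Notation C := R[i].
Implicit Types a b c d : {poly R}.

(** [v] is a positive multiple of a point of the segment, so it is nonzero. With
    [S = |x||y| + Re (x conj y)], [|v|^2 = 2 |x||y| S] gives [S > 0], and the two real parts are
    [|x| S] and [|y| S]. *)
Lemma bisector_gt0 (x y : C) (v := (normc y)%:C%C * x + (normc x)%:C%C * y) :
  (forall l : R, 0 <= l <= 1 -> x + l%:C%C * (y - x) != 0) ->
  0 < complex.Re (v * conjc x) /\ 0 < complex.Re (v * conjc y).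
Proof.
move=> seg.
have xn0 : x != 0 by have := seg 0; rewrite lexx ler01 mul0r addr0 => /(_ isT).
have yn0 : y != 0 by have := seg 1; rewrite lexx ler01 mul1r addrC subrK => /(_ isT).
have x0 : 0 < normc x by rewrite normc_gt0.
have y0 : 0 < normc y by rewrite normc_gt0.
have vn0 : v != 0.
  have l01 : 0 <= normc x / (normc x + normc y) <= 1.
    by apply/andP; split; [apply: divr_ge0|rewrite ler_pdivrMr]; lra.
  apply: contraNneq (seg _ l01) => v0.
  have s0 : (normc x + normc y)%:C%C != 0 :> C.
    by rewrite (fmorph_eq0 (real_complex R)); apply/eqP; lra.
  have sl : (normc x + normc y) * (normc x / (normc x + normc y)) = normc x.
    by rewrite mulrC divfK //; apply/eqP; lra.
  apply/eqP; apply: (mulfI s0); rewrite mulr0 -v0 /v mulrDr mulrA -rmorphM /= sl.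
  by rewrite rmorphD /=; ring.
have: 0 < normc v ^+ 2 by rewrite exprn_gt0 // normc_gt0.
have := Re_mul_conj x; have := Re_mul_conj y; rewrite -(Re_mul_conj v) /v.
move: (normc x) (normc y) x0 y0 => p q p0 q0.
case: x y {seg v vn0 xn0 yn0} => [x1 x2] [y1 y2] /= hy hx hv.
have hx' : x1 ^+ 2 + x2 ^+ 2 = p ^+ 2 by rewrite -hx; ring.
have hy' : y1 ^+ 2 + y2 ^+ 2 = q ^+ 2 by rewrite -hy; ring.
have pq : 0 < p * q + (x1 * y1 + x2 * y2).
  have : 0 < 2 * p * q * (p * q + (x1 * y1 + x2 * y2)).
    have -> : 2 * p * q * (p * q + (x1 * y1 + x2 * y2)) =
        q ^+ 2 * p ^+ 2 + p ^+ 2 * q ^+ 2 + 2 * p * q * (x1 * y1 + x2 * y2) by ring.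
    rewrite -{1}hx' -{2}hy'; apply: lt_le_trans hv _.
    by rewrite le_eqVlt; apply/orP; left; apply/eqP; ring.
  by rewrite pmulr_rgt0 // !mulr_gt0.
split.
  have -> : (q * x1 - 0 * x2 + (p * y1 - 0 * y2)) * x1 -
     (q * x2 + 0 * x1 + (p * y2 + 0 * y1)) * - x2 =
     q * (x1 ^+ 2 + x2 ^+ 2) + p * (x1 * y1 + x2 * y2) by ring.
  by rewrite hx' (_ : _ + _ = p * (p * q + (x1 * y1 + x2 * y2))) ?mulr_gt0 //; ring.
have -> : (q * x1 - 0 * x2 + (p * y1 - 0 * y2)) * y1 -
   (q * x2 + 0 * x1 + (p * y2 + 0 * y1)) * - y2 =
   p * (y1 ^+ 2 + y2 ^+ 2) + q * (x1 * y1 + x2 * y2) by ring.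
by rewrite hy' (_ : _ + _ = q * (p * q + (x1 * y1 + x2 * y2))) ?mulr_gt0 //; ring.
Qed.

Definition positive_on_axis c a := forall w, 0 < complex.Re (axis c w * conjc (axis a w)).

Lemma Re_div_gt0 (x y : C) : y != 0 ->
  (0 < complex.Re (x / y)) = (0 < complex.Re (x * conjc y)).
Proof.
move=> yn0; have yE : `|y| = (normc y)%:C%C by case: y {yn0}.
rewrite invc_norm mulrCA yE -rmorphXn -fmorphV /= Re_scale.
by rewrite pmulr_rgt0 // invr_gt0 exprn_gt0 // normc_gt0.
Qed.

Lemma hurwitz_axis a w : hurwitz a -> axis a w != 0.
Proof. exact: stable_axis. Qed.

Lemma SPR_positive c a : SPR c a -> positive_on_axis c a.
Proof. by case=> _ st ca w; have := ca w; rewrite Re_div_gt0 ?hurwitz_axis. Qed.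

(** For [a] monic of degree [n], the last clause is positivity at infinity; it also fixes the degree
    of [c]. *)
Definition SPR_cone n a c := [/\ (size c <= n.+1)%N, positive_on_axis c a & 0 < c`_n].

Lemma SPR_cone_SPR n a c : size a = n.+1 -> hurwitz a -> SPR_cone n a c -> SPR c a.
Proof.
move=> sa st [sc ca cn]; split=> // [|w]; last first.
  by rewrite Re_div_gt0 ?(stable_axis w st) //; exact: ca.
apply/eqP; rewrite sa eqn_leq sc /= ltnNge; apply/negP => h.
by rewrite nth_default ?ltxx in cn.
Qed.

Lemma re_dot_lead n c a : (size c <= n.+1)%N -> a \is monic -> size a = n.+1 ->
  (re_dot (cpoly c) (cpoly a))`_(n + n) = c`_n.
Proof.
move=> sc a1 sa; rewrite coef_re_dot_top ?size_cpoly ?sa //.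
rewrite -exprMn mul_i_Ni expr1n mulr1 !coef_cpoly (_ : a`_n = 1) ?conjc1 ?mulr1 //.
by move/monicP: a1; rewrite lead_coefE sa.
Qed.

Lemma size_re_dot_le n c a : (size c <= n.+1)%N -> (size a <= n.+1)%N ->
  (size (re_dot (cpoly c) (cpoly a)) <= (n + n).+1)%N.
Proof.
move=> sc sa; apply: leq_trans (size_re_dot _ _) _; rewrite !size_cpoly.
by move: (size c) (size a) sc sa => x y; lia.
Qed.

Lemma axisZ t c w : axis (t *: c) w = t%:C%C * axis c w.
Proof. by rewrite /axis /cpoly map_polyZ hornerZ. Qed.

(** By conjugation symmetry of real polynomials; this matches the half-line treated by
    [uniform_perturbation]. *)
Lemma positive_on_axis_half c a :
  (forall w, 0 <= w -> 0 < complex.Re (axis c w * conjc (axis a w))) ->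
  positive_on_axis c a.
Proof.
move=> ca w; have [w0|w0] := leP 0 w; first exact: ca.
by have := ca (- w); rewrite !axisN Re_conjM; apply; lra.
Qed.

Lemma SPR_cone_perturb n a c d : a \is monic -> size a = n.+1 ->
  (size c <= n.+1)%N -> (size d <= n.+1)%N ->
  (forall w, 0 <= complex.Re (axis c w * conjc (axis a w))) ->
  (forall w, complex.Re (axis c w * conjc (axis a w)) = 0 ->
      0 < complex.Re (axis d w * conjc (axis a w))) -> (c`_n = 0 -> 0 < d`_n) ->
  exists2 e : R, 0 < e & forall t : R, 0 < t <= e -> SPR_cone n a (c + t *: d).
Proof.
move=> a1 sa sc sd ca da dn.
have [||w _|w _||e e0 He] := @uniform_perturbation R (re_dot (cpoly c) (cpoly a))
  (re_dot (cpoly d) (cpoly a)) (n + n).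
- by rewrite size_re_dot_le ?sa.
- by rewrite size_re_dot_le ?sa.
- by rewrite horner_re_dot; exact: ca.
- by rewrite !horner_re_dot; exact: da.
- by rewrite !re_dot_lead.
exists e => // t /He[pos lead]; rewrite !re_dot_lead // in lead; split.
- apply: leq_trans (size_polyD _ _) _; rewrite geq_max sc.
  exact: leq_trans (size_scale_leq _ _) sd.
- apply: positive_on_axis_half => w /pos; rewrite !horner_re_dot.
  by rewrite axisD axisZ mulrDl -mulrA raddfD /= Re_scale.
by rewrite coefD coefZ.
Qed.

(** A weak common solution becomes strict by a small step in the improving direction aimed at the
    bisector of [a] and [b]. *)
Lemma common_SPR_cone n a b c :
  a \is monic -> hurwitz a -> size a = n.+1 ->
  b \is monic -> hurwitz b -> size b = n.+1 ->
  (forall w (l : R), 0 <= l <= 1 -> axis a w + l%:C%C * (axis b w - axis a w) != 0) ->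
  (size c <= n.+1)%N -> c != 0 ->
  (forall w, 0 <= complex.Re (axis c w * conjc (axis a w))) ->
  (forall w, 0 <= complex.Re (axis c w * conjc (axis b w))) ->
  exists c', SPR_cone n a c' /\ SPR_cone n b c'.
Proof.
move=> a1 sta sa b1 stb sb seg sc cn0 ca cb.
pose v w := (normc (axis b w))%:C%C * axis a w + (normc (axis a w))%:C%C * axis b w.
have normcJ (z : C) : normc (conjc z) = normc z by case: z => x y /=; rewrite sqrrN.
have [w|w|w|d [sd da db dn]] := improving_direction (v := v) a1 sta sa b1 stb sb sc cn0 ca cb.
- by rewrite /v !axisN !normcJ rmorphD !rmorphM /= !oppr0.
- by have [] := bisector_gt0 (seg w).
- by have [] := bisector_gt0 (seg w).
have [e e0 He] := SPR_cone_perturb a1 sa sc sd ca da dn.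
have [f f0 Hf] := SPR_cone_perturb b1 sb sc sd cb db dn.
exists (c + Num.min e f *: d); split; [apply: He|apply: Hf];
  by rewrite lt_min e0 f0 ge_min lexx ?orbT.
Qed.

Lemma Re_dot_linear_r (x y z : C) (t : R) : complex.Re (x * conjc (y + t%:C%C * z)) =
  complex.Re (x * conjc y) + t * complex.Re (x * conjc z).
Proof. by case: x y z => [x1 x2] [y1 y2] [z1 z2] /=; ring. Qed.

(** Here the denominator is perturbed; strict positivity, also at infinity, makes the conditions at
    zeros vacuous. *)
Lemma SPR_cone_open n a b c : a \is monic -> size a = n.+1 -> (size b <= n.+1)%N ->
  SPR_cone n a c ->
  exists2 e : R, 0 < e & forall t : R, 0 < t <= e -> positive_on_axis c (a + t *: b).
Proof.
move=> a1 sa sb [sc ca cn].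
have [||w _|w _||e e0 He] := @uniform_perturbation R (re_dot (cpoly c) (cpoly a))
  (re_dot (cpoly c) (cpoly b)) (n + n).
- by rewrite size_re_dot_le ?sa.
- by rewrite size_re_dot_le.
- by rewrite horner_re_dot ltW // ca.
- by rewrite horner_re_dot => h; have := ca w; rewrite /axis h ltxx.
- by rewrite re_dot_lead // => h; rewrite h ltxx in cn.
exists e => // t /He[pos _]; apply: positive_on_axis_half => w /pos.
by rewrite !horner_re_dot axisD axisZ Re_dot_linear_r.
Qed.
End Cones.

(** * Compactness and conclusion *)

Section Final.
Variable R : realType.
Local Notation C := R[i].
Implicit Types a b c d : {poly R}.

Definition pencil a b (l : R) : {poly R} := a + l *: (b - a).

Lemma axis_pencil a b l w :
  axis (pencil a b l) w = axis a w + l%:C%C * (axis b w - axis a w).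
Proof. by rewrite axisD axisZ axisB. Qed.

Definition row_dot n w a (v : 'rV[R]_n) :=
  complex.Re (axis (rVpoly v) w * conjc (axis a w)).

Lemma row_dot_continuous n w a : continuous (@row_dot n.+1 w a).
Proof.
have E v : @row_dot n.+1 w a v = \sum_(i < n.+1)
    v ord0 i * complex.Re (Complex 0 w ^+ i * conjc (axis a w)).
  rewrite /row_dot /axis (@horner_coef_wide _ n.+1); last by rewrite size_cpoly size_poly.
  rewrite mulr_suml raddf_sum /=; apply: eq_bigr => i _.
  by rewrite coef_cpoly coef_rVpoly_ord -mulrA Re_scale.
rewrite (funext E); apply: continuous_big => [|i _]; first exact: add_continuous.
move=> v; apply: (@continuousM _ _ (fun x : 'rV[R]_n.+1 => x ord0 i) (fun=> _)).
  exact: coord_continuous.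
exact: cst_continuous.
Qed.

Lemma row_dot_pencil n w a b l (v : 'rV[R]_n) :
  row_dot w (pencil a b l) v = row_dot w a v + l * row_dot w (b - a) v.
Proof. by rewrite /row_dot axis_pencil -axisB Re_dot_linear_r. Qed.

Lemma sphere_compact n : compact [set v : 'rV[R]_n.+1 | `|v| = 1].
Proof.
apply: bounded_closed_compact.
  by exists 1; split; [exact: num_real|move=> M M1 v /= ->; exact: ltW].
have /continuous_closedP cl := @norm_continuous R 'rV[R]_n.+1.
by apply: (cl [set x : R | x = 1]%classic); exact: closed_eq.
Qed.

Definition common_cone n a b := exists c, SPR_cone n a c /\ SPR_cone n b c.

(** Closedness in contrapositive form. Each [v] on the unit sphere violates an inequality strictly,
    and still does so for nearby [v] and [m]; compactness of the sphere gives one neighbourhood of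
    [l] for all [v]. *)
Lemma common_cone_closed n a b l :
  (forall v : 'rV[R]_n.+1, v != 0 ->
     exists w, row_dot w a v < 0 \/ row_dot w (pencil a b l) v < 0) ->
  exists2 e : R, 0 < e & forall m, `|m - l| < e -> ~ common_cone n a (pencil a b m).
Proof.
move=> neg.
pose P m (v : 'rV[R]_n.+1) := exists w, row_dot w a v < 0 \/ row_dot w (pencil a b m) v < 0.
have /compact_near_coveringP/(_ R (nbhs l) P _) near_sphere := @sphere_compact n.
have : \forall m \near l, ([set v : 'rV[R]_n.+1 | `|v| = 1] `<=` P m)%classic.
  apply: near_sphere => v /= v1.
  have /neg[w [wa|wl]] : v != 0 by rewrite -normr_eq0 v1 oner_neq0.
    have na : \forall z \near v, row_dot w a z < 0.
      exact: (cvgr_lt _ (@row_dot_continuous n w a v) _ wa).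
    by near=> z m => /=; exists w; left; near: z.
  (* Half of the margin [s] pays for moving [v], the other half for moving [l]. *)
  pose s := - row_dot w (pencil a b l) v; pose K := `|row_dot w (b - a) v| + 1.
  have s0 : 0 < s by rewrite oppr_gt0.
  have K0 : 0 < K by rewrite ltr_wpDl.
  have [nl nba] : (\forall z \near v, row_dot w (pencil a b l) z < - (s / 2)) /\
      (\forall z \near v, `|row_dot w (b - a) z| < K).
    split; first by apply: (cvgr_lt _ (@row_dot_continuous n w (pencil a b l) v)); rewrite /s; lra.
    by apply: (cvgr_norm_lt _ (@row_dot_continuous n w (b - a) v)); rewrite /K ltrDl.
  have nm : \forall m \near l, `|l - m| < s / 2 / K.
    apply/nbhs_ballP; exists (s / 2 / K); first by rewrite /= !divr_gt0.
    by move=> m; rewrite -ball_normE.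
  near=> z m => /=; exists w; right.
  have -> : row_dot w (pencil a b m) z =
      row_dot w (pencil a b l) z - (l - m) * row_dot w (b - a) z.
    by rewrite !row_dot_pencil; ring.
  have h1 : row_dot w (pencil a b l) z < - (s / 2) by near: z.
  have h2 : `|row_dot w (b - a) z| < K by near: z.
  have h3 : `|l - m| < s / 2 / K by near: m.
  have h4 : `|(l - m) * row_dot w (b - a) z| <= s / 2.
    have -> : s / 2 = s / 2 / K * K by rewrite divfK // gt_eqF.
    by rewrite normrM; apply: ler_pM => //; exact: ltW.
  have := ler_norm (- ((l - m) * row_dot w (b - a) z)); rewrite normrN; lra.
case/nbhs_ballP => e /= e0 He; exists e => // m ml [c [[sc ca _] [_ cm cn]]].
pose v := poly_rV c : 'rV[R]_n.+1.
have vE : rVpoly v = c by rewrite poly_rV_K.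
have vn0 : 0 < `|v|.
  rewrite normr_gt0; apply/eqP => v0; move: cn.
  by rewrite -vE v0 linear0 coef0 ltxx.
(* Normalizing [c] to the sphere keeps the signs. *)
have /He/(_ (`|v|^-1 *: v))[|w] : ball l e m by rewrite -ball_normE /= distrC.
  by rewrite /= normrZ normfV normr_id mulVf ?gt_eqF.
have dotZ d w' : row_dot w' d (`|v|^-1 *: v) = `|v|^-1 * complex.Re (axis c w' * conjc (axis d w')).
  by rewrite /row_dot linearZ /= vE axisZ -mulrA Re_scale.
by rewrite !dotZ !pmulr_rlt0 ?invr_gt0 // !ltNge !ltW //; case.
Unshelve. all: by end_near. Qed.

Lemma size_monic_sub n a b : a \is monic -> size a = n.+1 ->
  b \is monic -> size b = n.+1 -> (size (b - a)%R <= n)%N.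
Proof.
move=> /monicP a1 sa /monicP b1 sb; apply/leq_sizeP => j.
rewrite leq_eqVlt => /orP[/eqP <-|nj].
  by move: a1 b1; rewrite !lead_coefE sa sb coefB /= => -> ->; rewrite subrr.
by rewrite coefB !nth_default ?sa ?sb // subrr.
Qed.

Lemma pencil_monic n a b l : a \is monic -> size a = n.+1 ->
  b \is monic -> size b = n.+1 ->
  pencil a b l \is monic /\ size (pencil a b l) = n.+1.
Proof.
move=> a1 sa b1 sb; have sl : (size (l *: (b - a))%R < size a)%N.
  by rewrite sa ltnS (leq_trans (size_scale_leq _ _)) // (size_monic_sub a1 sa).
by split; rewrite ?size_polyDl // monicE lead_coefDl // -monicE.
Qed.

Lemma pencilE a b l : l *: b + (1 - l) *: a = pencil a b l.
Proof. by rewrite /pencil scalerBr scalerBl scale1r; ring. Qed.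

Lemma pencil_shift a b l m : pencil a b m = pencil a b l + (m - l) *: (b - a).
Proof. by rewrite /pencil -addrA -scalerDl; congr (_ + _ *: _); ring. Qed.

(** [Re (c conj p_m)] is a convex combination of two positive numbers, so no [p_m] vanishes on the
    axis. *)
Lemma stable_pencil_of_SPR n a b c : a \is monic -> size a = n.+1 ->
  b \is monic -> size b = n.+1 -> SPR c a -> SPR c b ->
  forall l, 0 <= l <= 1 -> hurwitz (pencil a b l).
Proof.
move=> a1 sa b1 sb ca cb l l01.
have cE m : cpoly (pencil a b m) = cpoly a + m%:C%C *: cpoly (b - a).
  by rewrite /cpoly rmorphD /= map_polyZ.
have st : hurwitz a by case: ca.
have h : stable (cpoly (pencil a b l)).
  rewrite cE; apply: (stable_homotopy _ _ st _ l01); first exact: cpoly_monic.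
    by rewrite !size_cpoly sa ltnS (size_monic_sub a1 sa).
  move=> m /andP[m0 m1] w; rewrite -cE.
  apply/eqP => mw; have := SPR_positive ca w; have := SPR_positive cb w.
  have : complex.Re (axis c w * conjc (axis (pencil a b m) w)) = 0.
    by rewrite [axis (pencil _ _ _) w]mw conjc0 mulr0.
  have -> : axis (pencil a b m) w = (axis a w + m%:C%C * axis b w) + (- m)%:C%C * axis a w.
    by rewrite axis_pencil rmorphN /=; ring.
  rewrite !Re_dot_linear_r; nra.
exact: h.
Qed.

Lemma common_cone_pencil n a b : a \is monic -> size a = n.+1 ->
  b \is monic -> size b = n.+1 ->
  (forall l, 0 <= l <= 1 -> hurwitz (pencil a b l)) ->
  forall l, 0 <= l <= 1 -> common_cone n a (pencil a b l).
Proof.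
move=> a1 sa b1 sb st.
have p0 : pencil a b 0 = a by rewrite /pencil scale0r addr0.
have sta : hurwitz a by rewrite -p0; apply: st; rewrite lexx ler01.
apply: unit_interval_ind.
- rewrite p0; suff aa : SPR_cone n a a by exists a.
  split=> [|w|]; first by rewrite sa.
    by rewrite Re_mul_conj exprn_gt0 // normc_gt0 hurwitz_axis.
  by move/monicP: a1; rewrite lead_coefE sa /= => ->.
- move=> l l01 [c [ca cl]]; have [m1 sm] := pencil_monic l a1 sa b1 sb.
  have sd : (size (b - a)%R <= n.+1)%N by rewrite leqW // (size_monic_sub a1 sa).
  have [e e0 He] := SPR_cone_open m1 sm sd cl.
  (* The opposite direction covers [m < l]. *)
  have [|f f0 Hf] := SPR_cone_open m1 sm (_ : (size (- (b - a))%R <= n.+1)%N) cl.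
    by rewrite size_polyN.
  exists (Num.min e f); first by rewrite lt_min e0.
  move=> m _; rewrite lt_min => /andP[me mf]; exists c; split=> //.
  case: cl => sc cl cn; split=> //; rewrite (pencil_shift _ _ l).
  have [ml|ml|->] := ltgtP m l.
  + have := Hf (l - m); rewrite scalerN -scaleNr opprB; apply.
    by move: mf; rewrite ltr0_norm; lra.
  + by apply: He; move: me; rewrite gtr0_norm; lra.
  + by rewrite subrr scale0r addr0.
move=> l l01 near; apply: contrapT => nl.
have [m1 sm] := pencil_monic l a1 sa b1 sb.
suff [e e0 He] : exists2 e : R, 0 < e &
    forall m, `|m - l| < e -> ~ common_cone n a (pencil a b m).
  by have [m [_ ml /(He _ ml)]] := near e e0.
(* If no inequality is violated at [v], then [v] is a weak common solution at [l], which
   [common_SPR_cone] makes strict. *)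
apply: common_cone_closed => v vn0; apply: contrapT => nv; apply: nl.
have sv : (size (rVpoly v) <= n.+1)%N by exact: size_poly.
apply: (common_SPR_cone a1 sta sa m1 (st l l01) sm _ sv).
(* The segment from [a] to [p_l] lies in the stable pencil, hence avoids 0 on the axis. *)
- move=> w k /andP[k0 k1].
  have -> : axis a w + k%:C%C * (axis (pencil a b l) w - axis a w) = axis (pencil a b (k * l)) w.
    by rewrite !axis_pencil rmorphM /=; ring.
  by apply/hurwitz_axis/st; case/andP: l01 => l0 l1; apply/andP; split; nra.
- by apply: contra_neq vn0 => v0; rewrite -[v]rVpolyK v0 linear0.
- by move=> w; rewrite leNgt; apply/negP => h; apply: nv; exists w; left.
- by move=> w; rewrite leNgt; apply/negP => h; apply: nv; exists w; right.
Qed.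

End Final.

Theorem theorem1 (R : realType) (n : nat) (a b : {poly R}) :
  (1 <= n)%N ->
  a \is monic -> size a = n.+1 ->
  b \is monic -> size b = n.+1 ->
  hurwitz a -> hurwitz b ->
  (exists c : {poly R}, SPR c a /\ SPR c b) <->
  (forall lambda : R, 0 <= lambda <= 1 ->
     hurwitz (lambda *: b + (1 - lambda) *: a)).
Proof.
move=> _ a1 sa b1 sb sta stb; split=> [[c [ca cb]] l l01|st].
  by rewrite pencilE; exact: (stable_pencil_of_SPR a1 sa b1 sb ca cb).
have [l l01||c [ca]] := common_cone_pencil a1 sa b1 sb _ (l := 1).
- by rewrite -pencilE; exact: st.
- by rewrite lexx ler01.
have -> : pencil a b 1 = b by rewrite /pencil scale1r addrC subrK.
by move=> cb; exists c; split; [exact: (SPR_cone_SPR sa)|exact: (SPR_cone_SPR sb)].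
Qed.
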